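(* Let $X\subset\mathbb{C}^d$ be a domain and let $H_k$ be an irreducible reproducing kernel Hilbert space of holomorphic functions on $X$ with reproducing kernel $k:X\times X\to\mathbb{C}$. Suppose that $H_k$ has the two-point Nevanlinna--Pick property and that $\mathrm{Mult}(H_k)=H^\infty(X)$ isometrically. If $F=(f_1,f_2):X\times X\to X\times X$ is a holomorphic map, then $$d_{(k^n)^{\otimes 2}}\bigl(F(x_1,x_2),F(y_1,y_2)\bigr)\le \sqrt{2}\; d_{(k^n)^{\otimes 2}}\bigl((x_1,x_2),(y_1,y_2)\bigr)$$ for all $(x_1,x_2),(y_1,y_2)\in X\times X$ and all integers $n\ge 1$.
   Context: Irreducibility: $H_k$ is called irreducible if $k(x,y)\neq 0$ for all $x,y\in X$, and $k(\cdot,x)$ and $k(\cdot,y)$ are linearly independent in $H_k$ whenever $x\ne y$. Multipliers: a function $\phi:X\to\mathbb{C}$ is a multiplier of $H_k$ if $\phi f\in H_k$ for all $f\in H_k$. Then $M_\phi f:=\phi f$ is a bounded operator on $H_k$, and $\|\phi\|_{\mathrm{Mult}(H_k)}$ denotes its operator norm. $\mathrm{Mult}(H_k)$ is the algebra of all multipliers of $H_k$. $H^\infty(X)$ is the algebra of all bounded holomorphic functions on $X$ with norm $\|\phi\|_\infty=\sup_{x\in X}|\phi(x)|$. ''$\mathrm{Mult}(H_k)=H^\infty(X)$ isometrically'' means that the two algebras coincide as sets of functions and $\|\phi\|_{\mathrm{Mult}(H_k)}=\|\phi\|_\infty$ for every $\phi$ in them. Two-point Nevanlinna--Pick property: $H_k$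 has this property if, whenever $x_1,x_2\in X$ and $w_1,w_2\in\mathbb{C}$ are such that the matrix $$\begin{bmatrix}(1-|w_1|^2)k(x_1,x_1)&(1-w_1\overline{w_2})k(x_1,x_2)\\(1-w_2\overline{w_1})k(x_2,x_1)&(1-|w_2|^2)k(x_2,x_2)\end{bmatrix}$$ is positive semidefinite, there exists $\phi\in\mathrm{Mult}(H_k)$ with $\phi(x_i)=w_i$ for $i=1,2$ and $\|\phi\|_{\mathrm{Mult}(H_k)}\le 1$. Distances: for a reproducing kernel $K$ on a set $Y$ with $K(y,y)\neq 0$ for all $y\in Y$, define $$d_K(x,y):=\sqrt{1-\frac{|K(x,y)|^2}{K(x,x)K(y,y)}}\qquad(x,y\in Y).$$ For an integer $n\ge1$, $k^n(x,y):=k(x,y)^n$, which is a reproducing kernel on $X$. For a kernel $K$ on $X$, $K^{\otimes 2}$ is the kernel on $X\times X$ given by $K^{\otimes2}((x_1,x_2),(y_1,y_2)):=K(x_1,y_1)K(x_2,y_2)$. Thus $(k^n)^{\otimes 2}((x_1,x_2),(y_1,y_2))=k(x_1,y_1)^n k(x_2,y_2)^n$. *)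

(* Defs.v *)
From mathcomp Require Import all_boot all_order all_algebra.
From mathcomp Require Import all_classical all_reals all_analysis.
From mathcomp Require Export complex.

Set Implicit Arguments.
Unset Strict Implicit.
Unset Printing Implicit Defensive.

Import Order.TTheory GRing.Theory Num.Theory.
Import numFieldNormedType.Exports.

Local Open Scope classical_set_scope.
Local Open Scope ring_scope.

Section ReproducingKernels.
Context {R : realType}.
Local Notation C := R[i].

(* The topology and the norm of the concrete field [C] are carried by its
   convertible alias [C^o], whence [C^o] wherever C^d or C is a normed space. *)
Definition is_domain (d : nat) (X : set 'rV[C^o]_d) : Prop :=
  [/\ open X, connected X & X !=set0].

(* [f] is a map defined only on a subset of [V], presented as a type [I] with
   an injection [j : I -> V].  When [j @` setT] is open, two extensions of [f]
   to [V] agree near [j i], so the choice of [g] is immaterial.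
   [differentiable] is Frechet differentiability over the complex numbers. *)
Definition holomorphic (I : Type) (V W : normedModType C)
    (j : I -> V) (f : I -> W) : Prop :=
  forall i : I, exists2 g : V -> W,
    (forall i' : I, g (j i') = f i') & differentiable g (j i).

Definition incl2 (d : nat) (X : set 'rV[C^o]_d) (p : X * X) :
    'rV[C^o]_d * 'rV[C^o]_d :=
  (val p.1, val p.2).

Definition dot_norm (T : Type) (dot : (T -> C) -> (T -> C) -> C)
    (f : T -> C) : R :=
  Num.sqrt (complex.Re (dot f f)).

(* A Hilbert space of functions on [T]; [rk_dot] is linear in its first
   argument and is only meaningful on [rk_space]. *)
Record rkhs (T : Type) := Rkhs {
  rk_space :> (T -> C) -> Prop;
  rk_dot : (T -> C) -> (T -> C) -> C;
  rk_ker : T -> T -> C;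
  rk_space0 : rk_space (fun=> 0);
  rk_space_lin : forall (a : C) f g, rk_space f -> rk_space g ->
    rk_space (fun x => a * f x + g x);
  rk_dot_lin : forall (a : C) f g h,
    rk_space f -> rk_space g -> rk_space h ->
    rk_dot (fun x => a * f x + g x) h = a * rk_dot f h + rk_dot g h;
  rk_dotC : forall f g, rk_space f -> rk_space g ->
    rk_dot g f = (rk_dot f g)^*;
  rk_dot_ge0 : forall f, rk_space f -> 0 <= rk_dot f f;
  rk_dot_eq0 : forall f, rk_space f -> rk_dot f f = 0 -> f = (fun=> 0);
  rk_complete : forall u : nat -> T -> C,
    (forall n, rk_space (u n)) ->
    (forall e : R, 0 < e -> exists N : nat, forall m n : nat,
      (N <= m)%N -> (N <= n)%N ->
      dot_norm rk_dot (u m \- u n) < e) ->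
    exists2 f : T -> C, rk_space f &
      (fun n => dot_norm rk_dot (u n \- f)) @ \oo --> (0 : R);
  rk_ker_space : forall x, rk_space (fun y => rk_ker y x);
  rk_reproducing : forall f x, rk_space f ->
    rk_dot f (fun y => rk_ker y x) = f x
}.

Definition rk_norm (T : Type) (H : rkhs T) (f : T -> C) : R :=
  dot_norm (rk_dot H) f.

Definition irreducible (T : Type) (H : rkhs T) : Prop :=
  (forall x y, rk_ker H x y != 0) /\
  (forall x y, x <> y -> forall a b : C,
    (forall z, a * rk_ker H z x + b * rk_ker H z y = 0) -> a = 0 /\ b = 0).

Definition multiplier (T : Type) (H : rkhs T) (phi : T -> C) : Prop :=
  forall f, H f -> H (fun x => phi x * f x).

(* Extended-real valued, so that no boundedness has to be presupposed. *)
Definition mult_norm (T : Type) (H : rkhs T) (phi : T -> C) : \bar R :=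
  ereal_sup [set (rk_norm H (fun x => phi x * f x))%:E
            | f in [set f | H f /\ rk_norm H f <= 1]].

Definition sup_norm (T : Type) (phi : T -> C) : \bar R :=
  ereal_sup [set (Normc.normc (phi x))%:E | x in [set: T]].

Definition Hinfty (d : nat) (X : set 'rV[C^o]_d) (phi : X -> C) : Prop :=
  holomorphic (W := C^o) (fun x : X => val x) phi /\ (sup_norm phi < +oo)%E.

Definition Mult_eq_Hinfty (d : nat) (X : set 'rV[C^o]_d) (H : rkhs X) : Prop :=
  (forall phi : X -> C, multiplier H phi <-> Hinfty phi) /\
  (forall phi : X -> C, multiplier H phi -> mult_norm H phi = sup_norm phi).

Definition psdmx (n : nat) (A : 'M[C]_n) : Prop :=
  forall v : 'cV[C]_n, 0 <= \sum_i \sum_j (v i 0)^* * A i j * v j 0.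

Definition pick_mx (n : nat) (T : Type) (k : T -> T -> C)
    (x : 'I_n -> T) (w : 'I_n -> C) : 'M[C]_n :=
  \matrix_(i, j) ((1 - w i * (w j)^*) * k (x i) (x j)).

Definition two_point_NP (T : Type) (H : rkhs T) : Prop :=
  forall (x : 'I_2 -> T) (w : 'I_2 -> C),
    psdmx (pick_mx (rk_ker H) x w) ->
    exists phi : T -> C, [/\ multiplier H phi, forall i, phi (x i) = w i
      & (mult_norm H phi <= 1)%E].

(* For a reproducing kernel the complex number under [complex.Re] is real. *)
Definition ker_dist (T : Type) (K : T -> T -> C) (x y : T) : R :=
  Num.sqrt (complex.Re (1 - `|K x y| ^+ 2 / (K x x * K y y))).

Definition ker_pow (T : Type) (k : T -> T -> C) (n : nat) (x y : T) : C :=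
  k x y ^+ n.

Definition ker_tensor2 (T : Type) (K : T -> T -> C) (p q : T * T) : C :=
  K p.1 q.1 * K p.2 q.2.

End ReproducingKernels.

Arguments rkhs R T : clear implicits.

(* Main.v *)
Require Import Defs.
From mathcomp Require Import all_boot all_order all_algebra.
From mathcomp Require Import all_classical all_reals all_analysis.
From mathcomp Require Import ring lra.

(** Write [c(x, y) = |k(x,y)|^2 / (k(x,x) k(y,y))], the squared cosine of the
    angle between the kernel functions at [x] and [y] ([cosq] below), so that
    [d_k^2 = 1 - c].  For the kernel [K = (k^n)^{(x)2}] one gets
    [d_K(x, y)^2 = 1 - (c(x_1,y_1) c(x_2,y_2))^n], and the theorem reduces to
    the inequality, for every holomorphic [f : X * X -> X],

      [c(f x, f y) >= a := c(x_1,y_1) c(x_2,y_2)]             (1)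

    Indeed, (1) for [f_1] and [f_2] gives
    [d_K(F x, F y)^2 <= 1 - a^{2n} <= 2 (1 - a^n) = 2 d_K(x, y)^2].

    Two facts about [X] alone lead to (1).

    - Every holomorphic [psi : X -> C] with [|psi| <= 1] is a contractive
      multiplier, because [Mult(H_k)] is isometrically the algebra of bounded
      holomorphic functions.  Positivity of its Pick matrix at two points is the
      Schwarz-Pick inequality ([schwarz_pick])
        [c(x,y) |1 - psi(x) psi(y)^*|^2 <= (1-|psi(x)|^2) (1-|psi(y)|^2)].
      If [psi(x) = 0] it says [|psi(y)|^2 <= 1 - c(x,y)] ([schwarz]).
    - By the two-point Nevanlinna-Pick property the last bound is attained: some
      [phi] of this kind has [phi(x) = 0] and [|phi(y)|^2 = 1 - c(x,y)]
      ([pick_extremal]).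

    Taking the extremal [phi] for the points [f x], [f y] and composing it with
    [f], (1) becomes a Schwarz lemma on the product: a holomorphic
    [Phi : X * X -> C] with [|Phi| <= 1] and [Phi(x_1, x_2) = 0] satisfies
      [|Phi(y_1, y_2)|^2 <= 1 - c(x_1,y_1) c(x_2,y_2)].
    Put [c = c(x_1,y_1)], [s = 1 - c] and consider the two slices
    [g = Phi(x_1, .)] and [h = Phi(y_1, .)].  The Schwarz-Pick inequality in the
    first variable shows that the pair [(sqrt c g, (h - c g) / sqrt s)] maps [X]
    into the unit ball of [C^2] ([pick_row]).  Its first entry vanishes at
    [x_2].  With [r_2] for the second entry and [b = r_2(y_2)], the function
    [sqrt (1 - |b|^2) sqrt c g / (1 - b^* r_2)] is bounded by 1 and vanishes at
    [x_2]; the Schwarz lemma in the second variable gives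
    [c |g(y_2)|^2 <= (1 - c(x_2,y_2)) (1 - |b|^2)].  As [h = c g + sqrt s r_2],
    the Cauchy-Schwarz inequality now bounds [|h(y_2)|^2] by
    [s + c (1 - c(x_2,y_2)) = 1 - c(x_1,y_1) c(x_2,y_2)]
    ([schwarz_slices]). *)

Set Implicit Arguments.
Unset Strict Implicit.
Unset Printing Implicit Defensive.

Import Order.TTheory GRing.Theory Num.Theory.
Import numFieldNormedType.Exports.

Local Open Scope classical_set_scope.
Local Open Scope ring_scope.

Local Notation Re := complex.Re.
Local Notation Im := complex.Im.

(** * Holomorphic functions *)

Section Holo.
Context {R : realType}.
Local Notation C := R[i].
Context (I : Type) (V : normedModType C) (j : I -> V).
Implicit Types f g : I -> C.
Local Notation holo := (holomorphic (W := C^o) j).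

Lemma holomorphic_cst (a : C) : holo (fun=> a).
Proof. by move=> i; exists (cst (a : C^o)) => //; exact: differentiable_cst. Qed.

Lemma holomorphicD f g : holo f -> holo g -> holo (fun i => f i + g i).
Proof.
move=> hf hg i; have [f' Ef df] := hf i; have [g' Eg dg] := hg i.
exists (f' + g'); last exact: differentiableD.
by move=> i'; rewrite -Ef -Eg.
Qed.

Lemma holomorphicM f g : holo f -> holo g -> holo (fun i => f i * g i).
Proof.
move=> hf hg i; have [f' Ef df] := hf i; have [g' Eg dg] := hg i.
exists (fun v => f' v * g' v).
  by move=> i'; rewrite -Ef -Eg.
exact: (@differentiableM C V f' g' (j i) df dg).
Qed.

Lemma holomorphicV f : (forall i, f i != 0) -> holo f -> holo (fun i => (f i)^-1).
Proof.
move=> f0 hf i; have [f' Ef df] := hf i.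
exists (fun v => (f' v)^-1).
  by move=> i'; rewrite -Ef.
apply: (@differentiableV C V f' (j i) df).
by rewrite Ef.
Qed.
End Holo.

(** The extensions compose because [f'] maps [j i] to [j' (f i)], the point at
    which [p] is differentiable. *)
Lemma holomorphic_comp (R : realType) (I J : Type) (U V W : normedModType R[i])
  (j : I -> U) (j' : J -> V) (f : I -> J) (phi : J -> W) :
  holomorphic j (fun i => j' (f i)) -> holomorphic j' phi ->
  holomorphic j (fun i => phi (f i)).
Proof.
move=> hf hphi i; have [f' Ef df] := hf i; have [p Ep dp] := hphi (f i).
exists (p \o f'); first by move=> i' /=; rewrite Ef Ep.
by apply: differentiable_comp => //; rewrite Ef.
Qed.

Section incl2.
Context {R : realType} (d : nat) (X : set 'rV[R[i]^o]_d).
Local Notation V := 'rV[R[i]^o]_d.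

Lemma holomorphic_pairl (a : X) :
  holomorphic (fun w : X => val w : V) (fun w => incl2 (w, a)).
Proof.
by move=> w; exists (fun v => (v, val a)) => //=; exact: differentiable_pair.
Qed.

Lemma holomorphic_pairr (a : X) :
  holomorphic (fun w : X => val w : V) (fun w => incl2 (a, w)).
Proof.
by move=> w; exists (fun v => (val a, v)) => //=; exact: differentiable_pair.
Qed.

Lemma holomorphic_fst (I : Type) (U : normedModType R[i]) (j : I -> U) (F : I -> X * X) :
  holomorphic j (fun i => incl2 (F i)) -> holomorphic j (fun i => val (F i).1 : V).
Proof.
move=> hF i; have [F' EF dF] := hF i.
exists (fst \o F'); first by move=> i' /=; rewrite EF.
apply: differentiable_comp => //.
apply: linear_differentiable.
by move=> z; exact: cvg_fst.
Qed.

Lemma holomorphic_snd (I : Type) (U : normedModType R[i]) (j : I -> U) (F : I -> X * X) :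
  holomorphic j (fun i => incl2 (F i)) -> holomorphic j (fun i => val (F i).2 : V).
Proof.
move=> hF i; have [F' EF dF] := hF i.
exists (snd \o F'); first by move=> i' /=; rewrite EF.
apply: differentiable_comp => //.
apply: linear_differentiable.
by move=> z; exact: cvg_snd.
Qed.

End incl2.

(** * Complex numbers in real coordinates *)

Section ComplexCoordinates.
Context {R : realType}.
Local Notation C := R[i].
Implicit Types z w : C.

(** The squared modulus, as a real number: order reasoning and [lra] then take
    place in [R] and not in the partially ordered field [R[i]]. *)
Definition nsq z : R := Re z ^+ 2 + Im z ^+ 2.

Lemma Re0 : Re (0 : C) = 0. Proof. by []. Qed.
Lemma Im0 : Im (0 : C) = 0. Proof. by []. Qed.
Lemma Re1 : Re (1 : C) = 1. Proof. by []. Qed.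
Lemma Im1 : Im (1 : C) = 0. Proof. by []. Qed.
Lemma ReR (r : R) : Re (r%:C)%C = r. Proof. by []. Qed.
Lemma ImR (r : R) : Im (r%:C)%C = 0. Proof. by []. Qed.
Lemma ReD z w : Re (z + w) = Re z + Re w. Proof. by case: z w => ? ? []. Qed.
Lemma ImD z w : Im (z + w) = Im z + Im w. Proof. by case: z w => ? ? []. Qed.
Lemma ReN z : Re (- z) = - Re z. Proof. by case: z. Qed.
Lemma ImN z : Im (- z) = - Im z. Proof. by case: z. Qed.
Lemma ReM z w : Re (z * w) = Re z * Re w - Im z * Im w.
Proof. by case: z w => ? ? []. Qed.
Lemma ImM z w : Im (z * w) = Re z * Im w + Im z * Re w.
Proof. by case: z w => ? ? []. Qed.
Lemma ReJ z : Re (z^*) = Re z. Proof. by case: z. Qed.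
Lemma ImJ z : Im (z^*) = - Im z. Proof. by case: z. Qed.

(** [ReR] and [ImR] come last because they also unify with products. *)
Definition coordE :=
  (ReD, ImD, ReN, ImN, ReM, ImM, ReJ, ImJ, Re0, Im0, Re1, Im1, ReR, ImR).

Lemma complex_inj z w : Re z = Re w -> Im z = Im w -> z = w.
Proof. by case: z w => ? ? [? ?] /= -> ->. Qed.

Lemma nsq_ge0 z : 0 <= nsq z.
Proof. by rewrite addr_ge0 ?sqr_ge0. Qed.

Lemma nsqM z w : nsq (z * w) = nsq z * nsq w.
Proof. rewrite /nsq !coordE; ring. Qed.

Lemma nsqJ z : nsq z^* = nsq z.
Proof. by rewrite /nsq !coordE sqrrN. Qed.

Lemma nsqR (r : R) : nsq (r%:C)%C = r ^+ 2.
Proof. by rewrite /nsq !coordE expr0n addr0. Qed.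

Lemma nsq_le0_eq0 z : nsq z <= 0 -> z = 0.
Proof.
move=> z0; have : nsq z == 0 by rewrite eq_le z0 nsq_ge0.
rewrite paddr_eq0 ?sqr_ge0 // !sqrf_eq0 => /andP[/eqP ? /eqP ?].
exact: complex_inj.
Qed.

Lemma nsqV z : nsq z^-1 = (nsq z)^-1.
Proof.
have [->|z0] := eqVneq z 0.
  by rewrite invr0 /nsq !coordE expr0n addr0 invr0.
have nz0 : nsq z != 0 by apply: contra_neq z0 => h; apply: nsq_le0_eq0; rewrite h.
apply: (mulfI nz0); rewrite -nsqM divff // divff // /nsq !coordE; ring.
Qed.

Lemma normc_nsq z : Normc.normc z = Num.sqrt (nsq z).
Proof. by case: z. Qed.

(** Nonnegativity of a Hermitian 2 x 2 form, stated as positivity of its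
    quadratic form, bounds its off-diagonal entry.  For the Gram form this is
    the Cauchy-Schwarz inequality, for a Pick matrix the Schwarz-Pick one. *)
Lemma posform_det (A B : R) z :
  (forall a b : C, 0 <= A * nsq a + B * nsq b + 2 * Re (a * b^* * z)) ->
  nsq z <= A * B.
Proof.
move=> H.
have A0 : 0 <= A by have := H 1 0; rewrite /nsq !coordE; lra.
have B0 : 0 <= B by have := H 0 1; rewrite /nsq !coordE; lra.
have [B1|B1] := ltrP 0 B.
  have := H (B%:C)%C (- z).
  have -> : A * nsq (B%:C)%C + B * nsq (- z) + 2 * Re ((B%:C)%C * (- z)^* * z) =
      B * (A * B - nsq z) by rewrite /nsq !coordE; ring.
  by rewrite pmulr_rge0 // subr_ge0.
have -> : B = 0 by lra.
(* Now [B = 0].  For [b = 1] and [a = - t z^*] the form is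
   [|z|^2 (A t^2 - 2 t)], which is negative for small [t > 0] if [z != 0]. *)
have := H ((- (A + 1)^-1)%:C * z^*)%C 1.
set t := (A + 1)^-1; have t0 : 0 < t by rewrite invr_gt0; lra.
have tA : A * t = 1 - t by rewrite /t; field; lra.
have -> : B = 0 by lra.
have -> : A * nsq ((- t)%:C%C * z^*) + 0 * nsq 1 +
    2 * Re ((- t)%:C%C * z^* * 1^* * z) = - (t * (1 + t) * nsq z).
  rewrite /nsq !coordE.
  transitivity ((A * t * t - 2 * t) * (Re z ^+ 2 + Im z ^+ 2)); first ring.
  by rewrite tA; ring.
rewrite oppr_ge0 pmulr_rle0; last by apply: mulr_gt0 => //; lra.
by rewrite mulr0.
Qed.

(** If [g], [h] satisfy the Schwarz-Pick inequality for
    points with squared cosine [c], then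
    [c |g|^2 + |h - c g|^2 / (1 - c) <= 1], written so that it makes sense for
    [c = 1].  When [g], [h] are values of a multiplier, the left side is the
    squared norm of what the compression of this multiplier to the span of the
    two kernel functions makes of the second one, normalized. *)
Lemma pick_row (c : R) g h : c <= 1 -> nsq h <= 1 ->
  c * nsq (1 - g * h^*) <= (1 - nsq g) * (1 - nsq h) ->
  nsq (h - c%:C%C * g) <= (1 - c) * (1 - c * nsq g).
Proof.
move=> c1 h1 pick.
have : 0 <= (1 - c) * (nsq g * (1 - nsq h)).
  by rewrite !mulr_ge0 ?nsq_ge0 // subr_ge0.
move: pick; rewrite /nsq !coordE; lra.
Qed.

(** For [k = 1], the two sides differ by [|z - b|^2]. *)
Lemma moebius_bound (k : R) b z : 0 <= k ->
  (1 - k * nsq b) * (1 - k * nsq z) <= nsq (1 - k%:C%C * (z * b^*)).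
Proof.
move=> k0.
have : 0 <= k * nsq (z - b) by rewrite mulr_ge0 ?nsq_ge0.
rewrite /nsq !coordE; lra.
Qed.

(** The Cauchy-Schwarz inequality
    [|p + q|^2 <= (u + v) (|p|^2 / u + |q|^2 / v)] without divisions. *)
Lemma nsqD_le (u v P Q : R) p q : 0 <= u -> 0 <= v -> 0 <= P -> 0 <= Q ->
  nsq p <= u * P -> nsq q <= v * Q -> nsq (p + q) <= (u + v) * (P + Q).
Proof.
move=> u0 v0 P0 Q0 hp hq.
pose x := 2 * (Re p * Re q + Im p * Im q).
have -> : nsq (p + q) = nsq p + nsq q + x by rewrite /nsq /x !coordE; ring.
suff : x <= u * Q + v * P by lra.
have m0 : 0 <= u * Q + v * P by rewrite addr_ge0 ?mulr_ge0.
have x2 : x ^+ 2 <= (u * Q + v * P) ^+ 2.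
  have : nsq p * nsq q <= u * P * (v * Q) by rewrite ler_pM ?nsq_ge0.
  have := sqr_ge0 (Re p * Im q - Im p * Re q).
  have := sqr_ge0 (u * Q - v * P).
  rewrite /x /nsq; lra.
rewrite (le_trans (ler_norm x)) // -(ger0_norm m0) -ler_sqr ?nnegrE //.
by rewrite !real_normK ?num_real.
Qed.

End ComplexCoordinates.

(** * Reproducing kernel Hilbert spaces and their multipliers *)

Section HilbertSpace.
Context {R : realType} (T : Type) (H : rkhs R T).
Local Notation C := R[i].
Local Notation dot := (rk_dot H).
Local Notation k := (rk_ker H).
Implicit Types (f g h : T -> C) (a b : C) (x y : T).

Definition lin2 a f b g : T -> C := fun z => a * f z + b * g z.
Definition ker_at x : T -> C := fun z => k z x.

Lemma lin2E a f b g : lin2 a f b g = fun z => a * f z + (b * g z + (fun=> 0) z).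
Proof. by apply/funext => z; rewrite addr0. Qed.

Lemma rk_space_scale a f : H f -> H (fun z => a * f z + (fun=> 0) z).
Proof. by move=> Hf; apply: rk_space_lin => //; exact: rk_space0. Qed.

Lemma rk_space_lin2 a f b g : H f -> H g -> H (lin2 a f b g).
Proof.
by move=> Hf Hg; rewrite lin2E; apply: rk_space_lin => //; exact: rk_space_scale.
Qed.

Lemma dot0l h : H h -> dot (fun=> 0) h = 0.
Proof.
move=> Hh; have /= E := rk_dot_lin (-1) (rk_space0 H) (rk_space0 H) Hh.
have E0 : (fun _ : T => -1 * 0 + 0) = (fun=> 0) :> (T -> C).
  by apply/funext => z; rewrite mulr0 addr0.
by move: E; rewrite E0 mulN1r addNr.
Qed.

Lemma dot_lin2l a f b g h : H f -> H g -> H h ->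
  dot (lin2 a f b g) h = a * dot f h + b * dot g h.
Proof.
move=> Hf Hg Hh; rewrite lin2E rk_dot_lin //; last exact: rk_space_scale.
by rewrite rk_dot_lin // ?dot0l ?addr0 //; exact: rk_space0.
Qed.

Lemma dot_lin2r a f b g h : H f -> H g -> H h ->
  dot h (lin2 a f b g) = a^* * dot h f + b^* * dot h g.
Proof.
move=> Hf Hg Hh; rewrite rk_dotC //; last exact: rk_space_lin2.
rewrite dot_lin2l // rmorphD !rmorphM /=.
by rewrite -!rk_dotC.
Qed.

Lemma ker_atH x : H (ker_at x). Proof. exact: rk_ker_space. Qed.
Hint Resolve ker_atH : core.

Lemma dot_ker_at f x : H f -> dot f (ker_at x) = f x.
Proof. exact: rk_reproducing. Qed.

Lemma dot_ge0 f : H f -> 0 <= Re (dot f f).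
Proof. by move=> /rk_dot_ge0; rewrite lecE => /andP[]. Qed.

Lemma Im_dot f : H f -> Im (dot f f) = 0.
Proof. by move=> /rk_dot_ge0; rewrite lecE => /andP[/eqP]. Qed.

Lemma Re_dot_lin2 a f b g : H f -> H g ->
  Re (dot (lin2 a f b g) (lin2 a f b g)) =
  Re (dot f f) * nsq a + Re (dot g g) * nsq b + 2 * Re (a * b^* * dot f g).
Proof.
move=> Hf Hg; have Hl := rk_space_lin2 a b Hf Hg.
rewrite dot_lin2l // !dot_lin2r // [dot g f]rk_dotC //.
have := Im_dot Hf; have := Im_dot Hg.
by rewrite /nsq !coordE => -> ->; ring.
Qed.

Lemma cauchy_schwarz f g : H f -> H g ->
  nsq (dot f g) <= Re (dot f f) * Re (dot g g).
Proof.
move=> Hf Hg; apply: posform_det => a b; rewrite -Re_dot_lin2 //.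
exact/dot_ge0/rk_space_lin2.
Qed.

Lemma kerC x y : k y x = (k x y)^*.
Proof.
rewrite -[k y x]/(ker_at x y) -[k x y]/(ker_at y x).
by rewrite -(dot_ker_at y (ker_atH x)) -(dot_ker_at x (ker_atH y)) rk_dotC.
Qed.

Lemma Im_ker x : Im (k x x) = 0.
Proof. by rewrite -[k x x]/(ker_at x x) -dot_ker_at // Im_dot. Qed.

Lemma Re_ker_ge0 x : 0 <= Re (k x x).
Proof. by rewrite -[k x x]/(ker_at x x) -dot_ker_at // dot_ge0. Qed.

Lemma Re_ker_gt0 x : k x x != 0 -> 0 < Re (k x x).
Proof.
move=> k0; rewrite lt_neqAle Re_ker_ge0 andbT eq_sym.
by apply: contra_neq k0 => h; apply: complex_inj; rewrite ?Im_ker.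
Qed.

(** The squared cosine of the angle between the kernel functions at [x] and
    [y]; the distance [d_k] is its sine. *)
Definition cosq x y : R := nsq (k x y) / (Re (k x x) * Re (k y y)).

Lemma cosq_ge0 x y : 0 <= cosq x y.
Proof.
by rewrite divr_ge0 ?nsq_ge0 // mulr_ge0 // Re_ker_ge0.
Qed.

Lemma nsq_ker_le x y : nsq (k x y) <= Re (k x x) * Re (k y y).
Proof.
have := cauchy_schwarz (ker_atH y) (ker_atH x).
by rewrite !dot_ker_at // mulrC.
Qed.

Lemma cosq_le1 x y : cosq x y <= 1.
Proof.
have := nsq_ker_le x y; rewrite /cosq le_eqVlt => /predU1P[->|lt].
  by have [->|?] := eqVneq (Re (k x x) * Re (k y y)) 0; rewrite ?mul0r // divff.
rewrite ler_pdivrMr ?mul1r ?ltW //.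
exact: le_lt_trans (nsq_ge0 _) lt.
Qed.

(** The bound of [mult_norm] on the unit ball extends to [f] by scaling; when
    [f] has norm 0 it is the zero function. *)
Lemma mult_norm_le phi f : multiplier H phi -> (mult_norm H phi <= 1)%E -> H f ->
  Re (dot (fun z => phi z * f z) (fun z => phi z * f z)) <= Re (dot f f).
Proof.
move=> mphi n1 Hf; have Hpf := mphi _ Hf.
have := dot_ge0 Hf; rewrite le_eqVlt => /predU1P[f0|f_gt0].
  have -> : (fun z => phi z * f z) = f.
    rewrite (rk_dot_eq0 Hf); first by apply/funext => z; rewrite mulr0.
    by apply: complex_inj; rewrite ?Im_dot.
  by [].
pose r := Num.sqrt (Re (dot f f)); have r0 : 0 < r by rewrite sqrtr_gt0.
have r2 : r ^+ 2 = Re (dot f f) by rewrite sqr_sqrtr // ltW.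
have EF g : H g -> Re (dot (lin2 (r^-1)%:C%C g 0 g) (lin2 (r^-1)%:C%C g 0 g)) =
    Re (dot g g) / r ^+ 2.
  move=> Hg; rewrite Re_dot_lin2 // nsqR /nsq !coordE exprVn; ring.
pose g := lin2 (r^-1)%:C%C f 0 f.
have Hg : H g by exact: rk_space_lin2.
have g1 : rk_norm H g <= 1.
  by rewrite /rk_norm /dot_norm EF // r2 divff ?sqrtr1 // gt_eqF.
have : ((rk_norm H (fun x => phi x * g x))%:E <= mult_norm H phi)%E.
  by apply: ereal_sup_ubound; exists g.
move=> /le_trans/(_ n1); rewrite lee_fin /rk_norm /dot_norm.
have -> : (fun x => phi x * g x) =
    lin2 (r^-1)%:C%C (fun z => phi z * f z) 0 (fun z => phi z * f z).
  by apply/funext => z; rewrite /g /lin2; ring.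
rewrite EF // -sqrtr1 ler_psqrt ?nnegrE ?divr_ge0 ?dot_ge0 ?sqr_ge0 //.
by rewrite ler_pdivrMr ?exprn_gt0 // mul1r r2.
Qed.

(** The Pick matrix of a contractive multiplier is positive.  The usual argument
    applies the adjoint of multiplication to [f = a k_x + b k_y], which gives
    [g = a phi(x)^* k_x + b phi(y)^* k_y].  Here [|g| <= |f|] is obtained
    without constructing the adjoint: [<phi g, f> = <g, g>], whence
    [|g|^2 <= |phi g| |f| <= |g| |f|]. *)
Lemma mult_pick phi x y : multiplier H phi -> (mult_norm H phi <= 1)%E ->
  nsq (1 - phi x * (phi y)^*) * nsq (k x y) <=
    (1 - nsq (phi x)) * Re (k x x) * ((1 - nsq (phi y)) * Re (k y y)).
Proof.
move=> mphi n1.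
have <- : nsq ((1 - (phi x)^* * phi y) * k y x) =
    nsq (1 - phi x * (phi y)^*) * nsq (k x y).
  by rewrite kerC /nsq !coordE; ring.
apply: posform_det => a b.
pose f := lin2 a (ker_at x) b (ker_at y).
pose g := lin2 (a * (phi x)^*) (ker_at x) (b * (phi y)^*) (ker_at y).
have Hf : H f by exact: rk_space_lin2.
have Hg : H g by exact: rk_space_lin2.
suff : Re (dot g g) <= Re (dot f f).
  rewrite !Re_dot_lin2 // !dot_ker_at // /ker_at !nsqM !nsqJ -subr_ge0.
  by congr (_ <= _); rewrite /nsq !coordE; ring.
have Epg : dot (fun z => phi z * g z) f = dot g g.
  have Hpg := mphi _ Hg.
  rewrite /f dot_lin2r // {3}/g dot_lin2r // !dot_ker_at // !rmorphM /= !conjCK.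
  by rewrite -/g !mulrA.
have pg := mult_norm_le mphi n1 Hg.
have := cauchy_schwarz (mphi _ Hg) Hf; rewrite Epg => cs.
have N0 := dot_ge0 Hg; have F0 := dot_ge0 Hf.
have {}cs : Re (dot g g) ^+ 2 <= Re (dot g g) * Re (dot f f).
  have -> : Re (dot g g) ^+ 2 = nsq (dot g g).
    by rewrite /nsq Im_dot // expr0n addr0.
  by apply: le_trans cs _; rewrite ler_wpM2r.
move: N0; rewrite le_eqVlt => /predU1P[<- //|N0].
by move: cs; rewrite expr2 ler_pM2l.
Qed.
End HilbertSpace.

(** * Schwarz lemmas *)

Section Schwarz.
Context {R : realType} (d : nat) (X : set 'rV[R[i]^o]_d) (H : rkhs R X).
Local Notation C := R[i].
Local Notation k := (rk_ker H).
Local Notation holo := (holomorphic (W := C^o) (fun x : X => val x)).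
Implicit Types (x y : X) (phi psi : X -> C).
Context (k0 : forall x, k x x != 0) (H_mult : Mult_eq_Hinfty H).

Lemma sup_norm_le1 phi : (sup_norm phi <= 1)%E <-> forall x, nsq (phi x) <= 1.
Proof.
have E x : (nsq (phi x) <= 1) = ((Normc.normc (phi x))%:E <= 1)%E.
  by rewrite lee_fin normc_nsq -{2}sqrtr1 ler_psqrt ?nnegrE // nsq_ge0.
split=> [h x|h].
  by rewrite E; apply: le_trans h; apply: ereal_sup_ubound; exists x.
by apply: ge_ereal_sup => _ [x _ <-]; rewrite -E.
Qed.

Lemma schwarz_pick phi x y : holo phi -> (forall z, nsq (phi z) <= 1) ->
  cosq H x y * nsq (1 - phi x * (phi y)^*) <=
    (1 - nsq (phi x)) * (1 - nsq (phi y)).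
Proof.
move=> hphi phi1; have s1 := (sup_norm_le1 phi).2 phi1.
have mphi : multiplier H phi.
  apply/H_mult.1; split=> //; apply: le_lt_trans s1 _; exact: ltry.
have := mult_pick x y mphi; rewrite H_mult.2 // => /(_ s1).
rewrite mulrACA => hp; rewrite /cosq mulrAC ler_pdivrMr; first by rewrite mulrC.
by rewrite mulr_gt0 // Re_ker_gt0.
Qed.

Lemma cosq_gt0 x y : k x y != 0 -> 0 < cosq H x y.
Proof.
move=> kn; rewrite divr_gt0 ?mulr_gt0 ?Re_ker_gt0 //.
by rewrite ltNge; apply: contra kn => /nsq_le0_eq0 ->.
Qed.

(** The bound [m] is arbitrary because the natural test functions, quotients
    such as [g / q] below, are not normalized. *)
Lemma schwarz psi x y (m : R) : 0 < m -> holo psi ->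
  (forall z, nsq (psi z) <= m) -> psi x = 0 ->
  nsq (psi y) <= (1 - cosq H x y) * m.
Proof.
move=> m0 hpsi psim psix0.
pose phi z := ((Num.sqrt m)^-1)%:C%C * psi z.
have Ephi z : nsq (phi z) = nsq (psi z) / m.
  by rewrite nsqM nsqR exprVn sqr_sqrtr ?ltW // mulrC.
have hphi : holo phi by exact/holomorphicM/hpsi/holomorphic_cst.
have phi1 z : nsq (phi z) <= 1 by rewrite Ephi ler_pdivrMr ?mul1r.
have := schwarz_pick x y hphi phi1.
have -> : phi x = 0 by rewrite /phi psix0 mulr0.
have -> : nsq (1 - 0 * (phi y)^*) = 1 by rewrite /nsq !coordE; ring.
have -> : nsq (0 : C) = 0 by rewrite /nsq !coordE; ring.
by rewrite mulr1 subr0 mul1r Ephi -ler_pdivrMr // lerBrDr -lerBrDl.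
Qed.

(** The Schwarz lemma on a product.  The functions [g] and [h] stand for the
    slices [Phi(x_1, .)] and [Phi(y_1, .)] of a function of two variables, and
    the first variable enters only through the Schwarz-Pick inequality between
    them, with constant [c]. *)
Lemma schwarz_slices (g h : X -> C) (c : R) x y : 0 < c -> c <= 1 ->
  holo g -> holo h ->
  (forall w, nsq (g w) <= 1) -> (forall w, nsq (h w) <= 1) ->
  (forall w, c * nsq (1 - g w * (h w)^*) <= (1 - nsq (g w)) * (1 - nsq (h w))) ->
  g x = 0 -> c * cosq H x y <= 1 - nsq (h y).
Proof.
move=> c0 c1 hg hh g1 h1 pick gx0.
(* Up to the factor [1 / sqrt s], [r] is the second entry of a map to the ball. *)
pose r w := h w - c%:C%C * g w.
pose s := 1 - c; have s0 : 0 <= s by rewrite subr_ge0.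
have hr : holo r.
  rewrite (_ : r = fun w => h w + (- c)%:C%C * g w).
    apply/holomorphicD/holomorphicM/hg/holomorphic_cst => //.
  by apply/funext => w; rewrite rmorphN mulNr.
have rle w : nsq (r w) <= s * (1 - c * nsq (g w)) by exact: pick_row.
have rle' w : s^-1 * nsq (r w) <= 1 - c * nsq (g w).
  (* If [s = 0] then [s^-1 = 0], and the claim is [|g|^2 <= 1]. *)
  move: s0; rewrite le_eqVlt => /predU1P[s0|s0].
    have cE : c = 1 by move: s0; rewrite /s; lra.
    by rewrite -s0 invr0 mul0r cE mul1r subr_ge0.
  by rewrite mulrC ler_pdivrMr // mulrC.
pose b := s^-1 * nsq (r y).
have b0 : 0 <= b by rewrite mulr_ge0 ?invr_ge0 ?nsq_ge0.
have t0 : 0 <= 1 - cosq H x y by rewrite subr_ge0 cosq_le1.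
have b1 : 0 <= 1 - b.
  rewrite subr_ge0; apply: le_trans (rle' y) _.
  by rewrite gerBl mulr_ge0 ?nsq_ge0 // ltW.
have rb : nsq (r y) <= s * b.
  rewrite /b; have := rle y; move: s0; rewrite le_eqVlt => /predU1P[<-|s0 _].
    by rewrite !mul0r.
  by rewrite mulrA divff ?mul1r // gt_eqF.
have key : c * nsq (g y) <= (1 - cosq H x y) * (1 - b).
  have := rle' y; rewrite -/b => hb.
  move: b1; rewrite le_eqVlt => /predU1P[b1|b1]; first by rewrite -b1 mulr0; lra.
  (* [g / q] is the test function for the Schwarz lemma; its bound comes from
     [(1 - b) c |g|^2 <= (1 - b) (1 - s^-1 |r|^2) <= |q|^2]. *)
  pose q w := 1 - (s^-1)%:C%C * (r w * (r y)^*).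
  have qle w : (1 - b) * (c * nsq (g w)) <= nsq (q w).
    apply: le_trans (moebius_bound (r y) (r w) _); last by rewrite invr_ge0.
    by rewrite -/b ler_pM2l //; have := rle' w; lra.
  have qn0 w : q w != 0.
    (* A zero of [q] would force [s^-1 |r w|^2 b = 1], where [b < 1]. *)
    apply/negP => /eqP /subr0_eq q1.
    have : (s^-1 * nsq (r w)) * b = 1.
      transitivity (nsq ((s^-1)%:C%C * (r w * (r y)^*))).
        by rewrite !nsqM nsqJ nsqR /b; ring.
      by rewrite -q1 /nsq !coordE expr1n expr0n addr0.
    have : (s^-1 * nsq (r w)) * b <= 1 * b.
      apply: ler_wpM2r => //; apply: le_trans (rle' w) _.
      by rewrite gerBl mulr_ge0 ?nsq_ge0 // ltW.
    by move: b1; lra.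
  have hq : holo (fun w => g w / q w).
    apply: holomorphicM => //; apply: holomorphicV => // w.
    have hrc := holomorphicM hr
      (holomorphic_cst _ ((- (s^-1))%:C%C * (r y)^*)).
    have [p Ep dp] := holomorphicD (holomorphic_cst _ 1) hrc w.
    by exists p => // w'; rewrite Ep /q rmorphN; ring.
  have m0 : 0 < ((1 - b) * c)^-1 by rewrite invr_gt0 mulr_gt0.
  have /(schwarz (x := x) y m0 hq) : forall w, nsq (g w / q w) <= ((1 - b) * c)^-1.
    move=> w; rewrite nsqM nsqV ler_pdivrMr; last first.
      by rewrite ltNge; apply: contra (qn0 w) => /nsq_le0_eq0 ->.
    by rewrite mulrC ler_pdivlMr ?mulr_gt0 // mulrC -mulrA.
  rewrite gx0 mul0r => /(_ erefl).
  have -> : q y = (1 - b)%:C%C.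
    by apply: complex_inj; rewrite /q /b /nsq !coordE; ring.
  rewrite nsqM nsqV nsqR ler_pdivrMr ?exprn_gt0 //.
  have -> : (1 - cosq H x y) * ((1 - b) * c)^-1 * (1 - b) ^+ 2 =
     (1 - cosq H x y) * (1 - b) / c by field; rewrite !gt_eqF.
  by rewrite ler_pdivlMr // mulrC.
have -> : h y = c%:C%C * g y + r y by rewrite /r; ring.
have : nsq (c%:C%C * g y + r y) <= (c * (1 - cosq H x y) + s) * ((1 - b) + b).
  apply: nsqD_le => //; first by rewrite mulr_ge0 // ltW.
  by rewrite nsqM nsqR expr2 -!mulrA ler_pM2l.
by rewrite subrK mulr1 /s; lra.
Qed.

(** With [w_1 = 0] and [|w_2|^2 = 1 - c(x,y)] the Pick matrix is positive of
    determinant 0, so that the Nevanlinna-Pick property provides an extremal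
    function for [schwarz]. *)
Lemma pick_extremal x y : two_point_NP H ->
  exists phi, [/\ holo phi, forall z, nsq (phi z) <= 1, phi x = 0 &
    nsq (phi y) = 1 - cosq H x y].
Proof.
move=> HNP; have c1 := cosq_le1 H x y.
pose w2 : R := Num.sqrt (1 - cosq H x y).
pose pts (i : 'I_2) := if i == 0 then x else y.
pose w (i : 'I_2) : C := if i == 0 then 0 else w2%:C%C.
have w22 : w2 ^+ 2 = 1 - cosq H x y by rewrite sqr_sqrtr // subr_ge0.
have /HNP[phi [mphi Ephi n1]] : psdmx (pick_mx k pts w).
  move=> v; rewrite !big_ord_recl !big_ord0 !mxE /pts /w /=.
  set a := v ord0 _; set b := v (lift _ _) _.
  rewrite [k y x]kerC.
  set A := Re (k x x); set B := Re (k y y); set z := k x y.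
  have A0 : 0 < A by exact: Re_ker_gt0.
  have B0 : 0 < B by exact: Re_ker_gt0.
  have Ec : cosq H x y * (A * B) = nsq z.
    by rewrite /cosq divfK // gt_eqF // mulr_gt0.
  have Ex : k x x = A%:C%C by apply: complex_inj; rewrite ?Im_ker.
  have Ey : k y y = B%:C%C by apply: complex_inj; rewrite ?Im_ker.
  rewrite Ex Ey lecE; apply/andP; split.
    by apply/eqP; rewrite !coordE; ring.
  (* As the determinant vanishes, [A] times the form is a squared modulus. *)
  rewrite -(pmulr_rge0 _ A0).
  rewrite [leRHS](_ : _ = nsq (A%:C%C * a + z * b)) ?nsq_ge0 //.
  transitivity (nsq (A%:C%C * a + z * b) + (A * B * (1 - w2 ^+ 2) - nsq z) * nsq b).
    by rewrite /nsq !coordE; ring.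
  by rewrite w22 subKr [A * B * _]mulrC Ec subrr mul0r addr0.
have [hphi _] := (H_mult.1 phi).1 mphi.
exists phi; split=> //.
- by apply/sup_norm_le1; rewrite -H_mult.2.
- by have := Ephi 0.
by have := Ephi 1; rewrite /pts /w /= => ->; rewrite nsqR.
Qed.
End Schwarz.

(** * Contraction of the distances *)

Section Main.
Context {R : realType} (d : nat) (X : set 'rV[R[i]^o]_d) (H : rkhs R X).
Local Notation C := R[i].
Local Notation k := (rk_ker H).
Local Notation V := 'rV[C^o]_d.
Context (H_irr : irreducible H) (H_mult : Mult_eq_Hinfty H)
  (H_NP : two_point_NP H).

Let k0 x : k x x != 0 := H_irr.1 x x.

(** Inequality (1) above: compose [f] with the function that is extremal for the
    points [f x] and [f y], and apply the Schwarz lemma on the product. *)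
Lemma cosq_contract (f : X * X -> X) (x y : X * X) :
  holomorphic (@incl2 R d X) (fun p => val (f p) : V) ->
  cosq H x.1 y.1 * cosq H x.2 y.2 <= cosq H (f x) (f y).
Proof.
move=> hf.
have [phi [hphi phi1 phi0 phiy]] := pick_extremal k0 H_mult (f x) (f y) H_NP.
have hpf : holomorphic (W := C^o) (@incl2 R d X) (fun p => phi (f p)).
  exact: holomorphic_comp hf hphi.
have hr a : holomorphic (W := C^o) (fun w : X => val w : V) (fun w => phi (f (a, w))).
  exact: holomorphic_comp (holomorphic_pairr a) hpf.
have hl a : holomorphic (W := C^o) (fun w : X => val w : V) (fun w => phi (f (w, a))).
  exact: holomorphic_comp (holomorphic_pairl a) hpf.
have : cosq H x.1 y.1 * cosq H x.2 y.2 <= 1 - nsq (phi (f (y.1, y.2))).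
  apply: (@schwarz_slices R d X H k0 H_mult (fun w => phi (f (x.1, w)))
    (fun w => phi (f (y.1, w)))) => //.
  - exact/(cosq_gt0 k0)/H_irr.1.
  - exact: cosq_le1.
  - by move=> w; apply: (schwarz_pick k0 H_mult x.1 y.1 (hl w)).
  - by rewrite -surjective_pairing.
by rewrite -surjective_pairing phiy subKr.
Qed.

Lemma ker_dist_tensor n (x y : X * X) :
  ker_dist (ker_tensor2 (ker_pow k n)) x y =
  Num.sqrt (1 - (cosq H x.1 y.1 * cosq H x.2 y.2) ^+ n).
Proof.
have kE z : k z z = (Re (k z z))%:C%C.
  by apply: complex_inj; rewrite ?Im_ker.
rewrite /ker_dist /ker_tensor2 /ker_pow; congr Num.sqrt.
rewrite -!exprMn normrX -exprM mulnC exprM -add_Re2_Im2 -/(nsq _) nsqM.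
rewrite -exprVn -exprMn.
rewrite (kE x.1) (kE x.2) (kE y.1) (kE y.2) -!rmorphM -fmorphV -rmorphM -rmorphXn.
rewrite -(rmorph1 (real_complex R)) -rmorphB /=.
by congr (1 - _ ^+ _); rewrite /cosq !invfM; ring.
Qed.

Lemma ker_dist_contract (f : X * X -> X * X) n x y :
  let K := ker_tensor2 (ker_pow k n) in
  holomorphic (@incl2 R d X) (fun p => incl2 (f p)) ->
  ker_dist K (f x) (f y) <= Num.sqrt 2 * ker_dist K x y.
Proof.
move=> K hf; rewrite /K !ker_dist_tensor -sqrtrM // ler_wsqrtr //.
set a := cosq H x.1 y.1 * cosq H x.2 y.2.
have a0 : 0 <= a by rewrite mulr_ge0 ?cosq_ge0.
have c1 : a <= cosq H (f x).1 (f y).1.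
  exact: (cosq_contract (f := fun p => (f p).1) x y (holomorphic_fst hf)).
have c2 : a <= cosq H (f x).2 (f y).2.
  exact: (cosq_contract (f := fun p => (f p).2) x y (holomorphic_snd hf)).
have : (a * a) ^+ n <= (cosq H (f x).1 (f y).1 * cosq H (f x).2 (f y).2) ^+ n.
  apply: lerXn2r; rewrite ?nnegrE.
  - exact: mulr_ge0.
  - by rewrite mulr_ge0 ?cosq_ge0.
  - exact: ler_pM.
(* [1 - t^2 <= 2 (1 - t)] for [t = a^n]. *)
rewrite exprMn -expr2; have := sqr_ge0 (1 - a ^+ n); lra.
Qed.
End Main.

Theorem theorem3p5 (R : realType) (d : nat) (X : set 'rV[R[i]^o]_d)
    (X_domain : is_domain X)
    (H : rkhs R X)
    (H_holo : forall f : X -> R[i], H f ->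
       holomorphic (W := R[i]^o) (fun x : X => val x) f)
    (H_irr : irreducible H)
    (H_NP : two_point_NP H)
    (H_mult : Mult_eq_Hinfty H)
    (F : X * X -> X * X)
    (F_holo : holomorphic (@incl2 R d X) (fun p => incl2 (F p)))
    (n : nat) (n_ge1 : (1 <= n)%N) (x y : X * X) :
  let K := ker_tensor2 (ker_pow (rk_ker H) n) in
  ker_dist K (F x) (F y) <= Num.sqrt 2 * ker_dist K x y.
Proof.
exact: ker_dist_contract.
Qed.
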